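(* Let $\mathcal{P}$ be a probability distribution on $\mathbb{R}^d$ such that $d$ points chosen independently from $\mathcal{P}$ are almost surely affinely independent, and let $Z_n$ denote the convex hull of $n$ points chosen independently from $\mathcal{P}$. If $E[f_{d-1}(Z_n)] \approx A n^{c}$ for some constants $A>0$ and $c>0$, then there exists an integer $n_0$ such that for every $n \ge n_0$, $$E[f_{d-1}(Z_{n+1})] > E[f_{d-1}(Z_n)].$$
   Context: $f_{d-1}(Z_n)$ denotes the number of facets ($(d-1)$-dimensional faces) of the polytope $Z_n$. The notation $a_n \approx b_n$ means that $a_n / b_n \to 1$ as $n \to \infty$. *)

(* Defs.v *)
From HB Require Import structures.
From mathcomp Require Import all_boot all_order all_algebra.
From mathcomp Require Import all_classical all_reals all_analysis.

Set Implicit Arguments.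
Unset Strict Implicit.
Unset Printing Implicit Defensive.

Import Order.TTheory GRing.Theory Num.Theory.
Import numFieldNormedType.Exports.


Local Open Scope ring_scope.

(* A point of R^d is a [d.-tuple R]
   (this type carries the product = Borel sigma-algebra of R^d in
   MathComp-Analysis); a sample of n points is an [n.-tuple (d.-tuple R)]. *)

Section Geometry.
Variables (R : realType) (d : nat).

Definition pt (x : d.-tuple R) : 'rV[R]_d := \row_(j < d) tnth x j.

Definition dotp (a p : 'rV[R]_d) : R := (a *m p^T) 0 0.

Definition lift1 (p : 'rV[R]_d) : 'rV[R]_(d + 1) := row_mx p (const_mx 1).

Definition affinely_independent k (p : 'I_k -> 'rV[R]_d) : bool :=
  \rank (\matrix_(i < k) lift1 (p i)) == k.

(* affine dimension of the point set {p i | i in S}: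
   (rank of the lifted points) - 1, so that the empty set has dimension -1 *)
Definition affdim n (p : 'I_n -> 'rV[R]_d) (S : {set 'I_n}) : int :=
  (\rank (\matrix_(i < n) (if i \in S then lift1 (p i) else 0)))%:Z - 1.

(* S is the index set {i | p i \in F} of a face F of the polytope
   conv{p i | i < n}: either F is the polytope itself, or F = P \cap H for a
   supporting hyperplane H = {y | <a,y> = b} (a <> 0, P in {<a,y> <= b}). *)
Definition face_index_set n (p : 'I_n -> 'rV[R]_d) (S : {set 'I_n}) : Prop :=
  S = [set: 'I_n]%SET \/
  exists (a : 'rV[R]_d) (b : R), a != 0 /\ (forall i, dotp a (p i) <= b) /\
    S = [set i | dotp a (p i) == b]%SET.

(* f_{d-1}(conv{p i}) : the number of (d-1)-dimensional faces (facets).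
   Faces are in bijection with their index sets {i | p i \in F}. *)
Definition num_facets n (p : 'I_n -> 'rV[R]_d) : nat :=
  #|[set S : {set 'I_n} |
      `[< face_index_set p S /\ affdim p S = (d%:Z - 1)%R >] ]|.

Definition iid_law n (P : probability (d.-tuple R) R)
    (Q : probability (n.-tuple (d.-tuple R)) R) : Prop :=
  forall A : 'I_n -> set (d.-tuple R), (forall i, measurable (A i)) ->
    Q [set x | forall i, A i (tnth x i)]%classic = (\prod_(i < n) P (A i))%E.

Definition expected_facets n (Q : probability (n.-tuple (d.-tuple R)) R)
    : \bar R :=
  (\int[Q]_x ((num_facets (fun i => pt (tnth x i)))%:R)%:E)%E.

End Geometry.

(* Main.v *)
(* Idea. Weight each injective d-tuple of sample points spanning a supporting
   hyperplane by the inverse of the number k (k - 1) ... (k - d + 1) of such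
   tuples inside that hyperplane, k being the number of sample points on it.
   Almost surely the weights sum to the number of facets, plus 1 if all points
   lie in one hyperplane (which is counted from both sides).  Hence
   E f_{d-1}(Z_n) + e_n = n (n - 1) ... (n - d + 1) h_n, where e_n in [0, 1] is
   nonincreasing and h_n is the mean weight of one tuple.  Since
   k |-> 1 / (k (k - 1) ... (k - d + 1)) is convex, so is h_n, whatever the
   mass that hyperplanes carry.  The asymptotics give h_n ~ A n^(c - d), and
   comparing the last decrement of h with its mean decrement over the last n / k
   steps yields (n + 1) (h_n - h_{n+1}) < d h_n for large n, i.e.
   monotonicity of the left-hand side; the term e_n only helps. *)
Require Import Defs.
From HB Require Import structures.
From mathcomp Require Import all_boot all_order all_algebra all_fingroup.
From mathcomp Require Import primitive_action alt.
From mathcomp Require Import all_classical all_reals all_analysis.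
From mathcomp Require Import measurable_realfun.
From mathcomp Require Import ring lra zify.

Set Implicit Arguments.
Unset Strict Implicit.
Unset Printing Implicit Defensive.

Import Order.TTheory GRing.Theory Num.Theory.
Import numFieldNormedType.Exports.
Local Open Scope ring_scope.

(** * Hyperplanes spanned by d points, and facets *)

Section NormalVector.
Variables (F : fieldType) (m : nat).
Implicit Types (M : 'M[F]_(m, m + 1)) (v : 'rV[F]_(m + 1)).

(** The generalised cross product of the rows of [M]. Its entries are polynomials in those of [M],
    from which the measurability of [side] is derived. *)
Definition normal_mx M : 'cV[F]_(m + 1) :=
  \col_k \det (col_mx M (delta_mx 0 k)).

Lemma mul_normal_mx M v : v *m normal_mx M = (\det (col_mx M v))%:M.
Proof.
apply/matrixP => i j; rewrite !ord1 !mxE eqxx mulr1n.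
have E (w : 'rV[F]_(m + 1)) : \det (col_mx M w) =
    \sum_k w 0 k * cofactor (col_mx M (0 : 'rV[F]_(m + 1))) (rshift m 0) k.
  rewrite (expand_det_row _ (rshift m 0)); apply: eq_bigr => k _.
  rewrite col_mxEd; congr (_ * _); rewrite /cofactor; congr (_ * \det _).
  apply/matrixP => a b; rewrite !mxE.
  case: splitP => // a' Ha; exfalso.
  have /eqP := neq_lift (rshift m (0 : 'I_1)) a; apply.
  by apply: val_inj; rewrite [RHS]Ha /= !ord1.
rewrite E; apply: eq_bigr => k _; rewrite !mxE; congr (_ * _).
rewrite E (bigD1 k) //= big1 ?addr0 ?mxE ?eqxx ?mul1r // => l lk.
by rewrite mxE (negbTE lk) andbF mul0r.
Qed.

Lemma mul_mx_normal M : M *m normal_mx M = 0.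
Proof.
apply/row_matrixP => i; rewrite row_mul mul_normal_mx row0.
rewrite (@determinant_alternate _ _ _ (lshift 1 i) (rshift m 0)) ?raddf0 //.
  by rewrite -val_eqE /= addn0 neq_ltn ltn_ord.
by move=> j; rewrite col_mxEu col_mxEd mxE.
Qed.

(** A nonzero maximal minor forces full rank. Conversely, if [M] is free and all these minors
    vanish, every unit row vector lies in the row space of [M], whose dimension is only m. *)
Lemma normal_mx_neq0 M : (normal_mx M != 0) = row_free M.
Proof.
apply/idP/idP => [nz|freeM].
  have /rV0Pn [k] : (normal_mx M)^T != 0 by rewrite trmx_eq0.
  rewrite !mxE => det_nz.
  have : row_free (col_mx M (delta_mx 0 k : 'rV_(m + 1))) by rewrite row_free_unit unitmxE unitfE.
  rewrite -!row_leq_rank -addsmxE => /leq_trans /(_ (mxrank_adds_leqif _ _)).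
  by rewrite mxrank_delta leq_add2r.
apply: contraTneq freeM => nM0.
apply/negP => freeM.
have full : (1%:M <= M)%MS.
  apply/row_subP => k; rewrite row1.
  have dk : \det (col_mx M (delta_mx 0 k)) = 0.
    by have := congr1 (fun c : 'cV_(m + 1) => c k 0) nM0; rewrite !mxE.
  have /negP nfree : ~~ row_free (col_mx M (delta_mx 0 k : 'rV_(m + 1))).
    by rewrite row_free_unit unitmxE unitfE dk eqxx.
  apply/negPn/negP => nsub; apply: nfree.
  rewrite -row_leq_rank -addsmxE mxrank_disjoint_sum ?mxrank_delta ?(eqP freeM) //.
  apply/eqP/rowV0P => w; rewrite sub_capmx => /andP [wM /sub_rVP [a wa]].
  apply/eqP/negPn/negP => wnz; case/negP: nsub.
  have anz : a != 0 by apply: contraNneq wnz => a0; rewrite wa a0 scale0r.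
  have -> : (delta_mx 0 k : 'rV[F]_(m + 1)) = a^-1 *: w.
    by rewrite wa scalerA mulVf // scale1r.
  exact: scalemx_sub.
have := mxrankS full; rewrite mxrank1 (eqP freeM).
by rewrite addn1 ltnn.
Qed.

Lemma annihilator_unique M (u w : 'cV[F]_(m + 1)) :
  row_free M -> u != 0 -> M *m u = 0 -> M *m w = 0 -> exists a, w = a *: u.
Proof.
move=> freeM unz Mu Mw.
have rk : \rank (kermx M^T) = 1%N.
  by rewrite mxrank_ker mxrank_tr (eqP freeM) addKn.
have su : (u^T <= kermx M^T)%MS by apply/sub_kermxP; rewrite -trmx_mul Mu trmx0.
have sw : (w^T <= kermx M^T)%MS by apply/sub_kermxP; rewrite -trmx_mul Mw trmx0.
have ru : \rank u^T = 1%N by apply/eqP; rewrite rank_rV trmx_eq0 unz.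
have /sub_rVP [a wa] : (w^T <= u^T)%MS.
  have [_ eq_sub] := mxrank_leqif_sup su.
  by apply: submx_trans sw _; rewrite -eq_sub ru rk.
by exists a; apply: trmx_inj; rewrite wa linearZ.
Qed.

End NormalVector.

Section Facets.
Variables (R : realType) (d : nat).
Implicit Types (t : 'I_d -> 'rV[R]_d) (q : 'rV[R]_d).

Definition lift_mx t : 'M[R]_(d, d + 1) := \matrix_(i < d) lift1 (t i).

(** The orientation determinant of the points [t] followed by [q]; it vanishes for all [q] when [t]
    is affinely dependent. *)
Definition side t q : R := (lift1 q *m normal_mx (lift_mx t)) 0 0.

Lemma sideP t q : side t q = 0 <-> lift1 q *m normal_mx (lift_mx t) = 0.
Proof.
split; last by rewrite /side => ->; rewrite mxE.
by move=> s0; apply/matrixP => i j; rewrite !ord1 [RHS]mxE.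
Qed.

Lemma affinely_independent_normal t :
  affinely_independent t = (normal_mx (lift_mx t) != 0).
Proof. by rewrite normal_mx_neq0. Qed.

Lemma lift_mx_mul0 t (c : 'cV[R]_(d + 1)) :
  (forall i, lift1 (t i) *m c = 0) -> lift_mx t *m c = 0.
Proof.
by move=> tc; apply/row_matrixP => i; rewrite row_mul rowK tc row0.
Qed.

Lemma side_self t i : side t (t i) = 0.
Proof.
by apply/sideP; have := congr1 (row i) (mul_mx_normal (lift_mx t));
   rewrite row_mul rowK row0.
Qed.

Lemma side_proportional t t' : affinely_independent t ->
  (forall i, side t' (t i) = 0) -> exists a, forall q, side t' q = a * side t q.
Proof.
move=> ind_t t0.
have [//||a na] := @annihilator_unique _ _ (lift_mx t) (normal_mx (lift_mx t))
  (normal_mx (lift_mx t')) ind_t _ (mul_mx_normal _).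
- by rewrite -affinely_independent_normal.
- by apply: lift_mx_mul0 => i; apply/sideP.
by exists a => q; rewrite /side na -scalemxAr mxE.
Qed.

Section Configuration.
Variables (n : nat) (p : 'I_n -> 'rV[R]_d).

Definition zeros t : {set 'I_n} := [set i | side t (p i) == 0]%SET.

Definition one_sided t :=
  [forall i, 0 <= side t (p i)] || [forall i, side t (p i) <= 0].

Lemma one_sidedZ t (s : 'rV[R]_d -> R) a : a != 0 ->
    (forall q, s q = a * side t q) ->
  ([forall i, 0 <= s (p i)] || [forall i, s (p i) <= 0]) = one_sided t.
Proof.
move=> a0 sE; rewrite /one_sided.
have /orP [a_lt0|a_gt0] : (a < 0) || (0 < a) by rewrite -neq_lt.
- rewrite orbC; congr (_ || _); apply: eq_forallb => i; rewrite sE.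
  + by rewrite nmulr_rle0.
  + by rewrite nmulr_rge0.
- congr (_ || _); apply: eq_forallb => i; rewrite sE.
  + by rewrite pmulr_rge0.
  + by rewrite pmulr_rle0.
Qed.

Definition subset_mx (S : {set 'I_n}) : 'M[R]_(n, d + 1) :=
  \matrix_(i < n) (if i \in S then lift1 (p i) else 0).

(** A maximal independent family of rows of [subset_mx S] spans all its rows; it contains no zero
    row, so its indices lie in [S]. *)
Lemma full_rank_subset S : \rank (subset_mx S) = d -> exists f : {ffun 'I_d -> 'I_n},
  [/\ forall i, f i \in S, affinely_independent (p \o f) &
      (subset_mx S <= lift_mx (p \o f))%MS].
Proof.
move=> rS.
have : exists f : 'I_(\rank (subset_mx S)) -> 'I_n,
  [/\ forall i, f i \in S, row_free (\matrix_i lift1 (p (f i))) &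
      (subset_mx S <= \matrix_i lift1 (p (f i)))%MS].
  exists (maxrankfun (subset_mx S)).
  have fS i : maxrankfun (subset_mx S) i \in S.
    apply: contraT => niS.
    have := maxrowsub_free (subset_mx S); set B := rowsub _ _ => freeB.
    have : (delta_mx 0 i : 'rV_(\rank (subset_mx S))) *m B = 0.
      by rewrite -rowE; apply/rowP => j; rewrite !mxE (negbTE niS) mxE.
    move/eqP; rewrite mulmx_free_eq0 // => /eqP /rowP /(_ i) /eqP.
    by rewrite !mxE !eqxx oner_eq0.
  have E : \matrix_i lift1 (p (maxrankfun (subset_mx S) i)) =
           rowsub (maxrankfun (subset_mx S)) (subset_mx S).
    by apply/row_matrixP => i; rewrite row_rowsub !rowK fS.
  split => //; rewrite E; first exact: maxrowsub_free.
  by rewrite eq_maxrowsub.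
rewrite rS => -[f [fS f_ind f_sub]]; exists (finfun f).
have E : lift_mx (p \o finfun f) = \matrix_i lift1 (p (f i)).
  by apply/row_matrixP => i; rewrite !rowK /= ffunE.
by split => [i||]; rewrite ?ffunE // ?E // /affinely_independent -/(lift_mx _) E.
Qed.

Hypothesis d_gt0 : (0 < d)%N.

(** If the linear part were 0, [side t] would be constant, hence 0 since it vanishes at a point of
    [t] (there is one as 0 < d), and the normal vector would be 0. *)
Lemma side_affine t : affinely_independent t ->
  exists (a : 'rV[R]_d) (b : R), a != 0 /\ forall q, side t q = dotp a q - b.
Proof.
move=> ind_t; pose c := normal_mx (lift_mx t).
have cE q : side t q = dotp (usubmx c)^T q - - dsubmx c 0 0.
  rewrite /side -/c -{1}[c]vsubmxK /lift1 mul_row_col mxE opprK; congr (_ + _).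
    by rewrite /dotp !mxE; apply: eq_bigr => k _; rewrite !mxE mulrC.
  by rewrite mxE big_ord1 mxE mul1r.
exists (usubmx c)^T, (- dsubmx c 0 0); split => //.
apply/eqP => a0; move: ind_t; rewrite affinely_independent_normal => /eqP; apply.
have b0 : dsubmx c 0 0 = 0.
  have := side_self t (Ordinal d_gt0).
  by rewrite cE a0 /dotp mul0mx mxE opprK add0r.
rewrite -/c -[c]vsubmxK; move/eqP: a0; rewrite trmx_eq0 => /eqP ->.
rewrite (_ : dsubmx c = 0) ?col_mx0 //.
by apply/matrixP => i j; rewrite !ord1 [LHS]b0 mxE.
Qed.

Definition facet_index (S : {set 'I_n}) :=
  [exists f : {ffun 'I_d -> 'I_n},
    [&& affinely_independent (p \o f), one_sided (p \o f) & S == zeros (p \o f)]].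

(** Dimension d - 1 provides d affinely independent points in the face, and up to a factor only one
    affine function vanishes on them; so the supporting hyperplane is the one they span. *)
Lemma facet_indexP S :
  face_index_set p S /\ affdim p S = (d%:Z - 1)%R <-> facet_index S.
Proof.
rewrite /affdim -/(subset_mx S); split.
  move=> [fS /addIr [/full_rank_subset [f [f_in f_ind f_sub]]]].
  apply/existsP; exists f; rewrite f_ind /=.
  (* First the degenerate face: the whole polytope has dimension d - 1, and [side] vanishes at all
     its points. *)
  case: fS => [ST|[a [b [a0 [ab Sab]]]]].
    have s0 i : side (p \o f) (p i) = 0.
      apply/sideP; have /submxP [D Dp] : (lift1 (p i) <= lift_mx (p \o f))%MS.
        by apply: submx_trans f_sub; rewrite (_ : lift1 _ = row i (subset_mx S))
           ?row_sub // rowK ST inE.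
      by rewrite Dp -mulmxA mul_mx_normal mulmx0.
    apply/andP; split; first by apply/orP; left; apply/forallP => i; rewrite s0.
    by rewrite ST; apply/eqP/setP => i; rewrite !inE s0 eqxx.
  pose l : 'cV[R]_(d + 1) := col_mx a^T (- b)%:M.
  have lE q : lift1 q *m l = (dotp a q - b)%:M.
    apply/matrixP => i j; rewrite !ord1 /l /lift1 mul_row_col mxE [RHS]mxE eqxx mulr1n.
    congr (_ + _); last by rewrite mxE big_ord1 !mxE mul1r eqxx mulr1n.
    by rewrite /dotp !mxE; apply: eq_bigr => k _; rewrite !mxE mulrC.
  have [|||c lc] := @annihilator_unique _ _ (lift_mx (p \o f))
      (normal_mx (lift_mx (p \o f))) l f_ind.
  - by rewrite -affinely_independent_normal.
  - exact: mul_mx_normal.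
  - apply: lift_mx_mul0 => i; rewrite lE /=.
    by have := f_in i; rewrite Sab inE => /eqP ->; rewrite subrr raddf0.
  have c0 : c != 0.
    apply: contra_neq a0 => c0; move: lc; rewrite c0 scale0r /l -col_mx0.
    by move=> /eq_col_mx [/eqP]; rewrite trmx_eq0 => /eqP.
  have sE q : dotp a q - b = c * side (p \o f) q.
    have := congr1 (fun A : 'M[R]_1 => A 0 0) (lE q).
    by rewrite lc -scalemxAr mxE [RHS]mxE eqxx mulr1n /side => <-.
  apply/andP; split.
    rewrite -(one_sidedZ c0 sE); apply/orP; right; apply/forallP => i.
    by rewrite subr_le0.
  apply/eqP; rewrite Sab; apply/setP => i; rewrite !inE.
  by rewrite -subr_eq0 sE mulf_eq0 (negbTE c0).
move=> /existsP [f /and3P [f_ind f_os /eqP SE]]; split.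
  right; have [a [b [a0 sE]]] := side_affine f_ind.
  have {f_os} [/forallP s0|/forallP s0] := orP f_os.
    exists (- a), (- b); rewrite oppr_eq0; split => //.
    have dN q : dotp (- a) q = - dotp a q by rewrite /dotp mulNmx mxE.
    split => [i|]; first by rewrite dN lerN2 -subr_ge0 -sE.
    by rewrite SE; apply/setP => i; rewrite !inE dN eqr_opp -[RHS]subr_eq0 sE.
  exists a, b; split => //; split => [i|]; first by rewrite -subr_le0 -sE.
  by rewrite SE; apply/setP => i; rewrite !inE sE subr_eq0.
(* The rank is at most d because the nonzero normal annihilates the rows, and at least d because the
   lifted points of [f] are among them. *)
congr (_%:Z - 1); apply/eqP; rewrite eqn_leq; apply/andP; split.
  have rk : (\rank (subset_mx S) + \rank (normal_mx (lift_mx (p \o f))) <= d + 1)%N.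
    apply: mulmx0_rank_max; apply/row_matrixP => i; rewrite row_mul rowK row0.
    case: ifP => [|_]; last by rewrite mul0mx.
    by rewrite SE inE => /eqP /sideP.
  have : (0 < \rank (normal_mx (lift_mx (p \o f))))%N.
    by rewrite lt0n mxrank_eq0 -affinely_independent_normal.
  move=> r_gt0; rewrite -(leq_add2r 1); apply: leq_trans rk.
  by rewrite leq_add2l.
rewrite -[X in (X <= _)%N](eqP f_ind); apply: mxrankS; apply/row_subP => i.
rewrite rowK (_ : lift1 _ = row (f i) (subset_mx S)) ?row_sub //.
by rewrite rowK SE inE side_self eqxx.
Qed.

Lemma num_facetsE : num_facets p = #|[set S | facet_index S]%SET|.
Proof.
apply: eq_card => S; rewrite !inE.
by apply/asboolP/idP => /facet_indexP.
Qed.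

(* A hyperplane containing all the points is counted for both of its sides:
   without this, the weight would not be convex in the number of points. *)
Definition facet_weight t : R :=
  (affinely_independent t)%:R *
  ([forall i, 0 <= side t (p i)]%:R + [forall i, side t (p i) <= 0]%:R) *
  ((#|zeros t| ^_ d)%N%:R)^-1.

Section GeneralPosition.
Hypothesis p_gen :
  forall f : {ffun 'I_d -> 'I_n}, injectiveb f -> affinely_independent (p \o f).

(** d independent points on the hyperplane of [g] span that same hyperplane, so the two [side]
    functions differ by a nonzero factor. *)
Lemma zeros_spanned (f g : {ffun 'I_d -> 'I_n}) : injectiveb f -> injectiveb g ->
  (forall i, f i \in zeros (p \o g)) ->
  zeros (p \o f) = zeros (p \o g) /\ one_sided (p \o f) = one_sided (p \o g).
Proof.
move=> /p_gen f_ind /p_gen g_ind fg.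
have [i|a sE] := side_proportional (t' := p \o g) f_ind.
  by have := fg i; rewrite inE => /eqP.
(* A zero factor would make the affine function [side (p \o g)] vanish at 0 and at the unit vectors,
   hence have zero linear part. *)
have a0 : a != 0.
  have := g_ind; apply: contraTneq => a0; rewrite affinely_independent_normal negbK.
  have [u [b [u0 sE']]] := side_affine g_ind; exfalso; case/eqP: u0.
  have b0 : b = 0.
    have := sE 0; rewrite a0 mul0r sE' /dotp trmx0 mulmx0 mxE sub0r => /eqP.
    by rewrite oppr_eq0 => /eqP.
  apply/rowP => k; have := sE (delta_mx 0 k).
  by rewrite a0 mul0r sE' b0 subr0 /dotp trmx_delta -colE mxE => ->; rewrite mxE.
split; first by apply/setP => i; rewrite !inE sE mulf_eq0 (negbTE a0).
by rewrite -(one_sidedZ a0 sE).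
Qed.

(** In general position, the injective tuples spanning a given hyperplane are exactly the injective
    tuples of sample points on it. *)
Lemma card_spanning (g : {ffun 'I_d -> 'I_n}) : injectiveb g ->
  #|[set f : {ffun 'I_d -> 'I_n} |
       injectiveb f && (zeros (p \o f) == zeros (p \o g))]%SET| =
  (#|zeros (p \o g)| ^_ d)%N.
Proof.
move=> g_inj; rewrite -[X in (_ ^_ X)%N]card_ord -card_inj_ffuns_on; apply: eq_card => f.
rewrite !inE andbC; case f_inj: (injectiveb f); rewrite ?andbF ?andbT //.
apply/eqP/ffun_onP => [<- i|fg]; first by rewrite inE side_self.
by have [] := zeros_spanned f_inj g_inj fg.
Qed.

Lemma facet_weight_one_sided (t : 'I_d -> 'rV[R]_d) : affinely_independent t ->
  facet_weight t = (one_sided t)%:R *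
    (1 + (zeros t == [set: 'I_n]%SET)%:R) * ((#|zeros t| ^_ d)%N%:R)^-1.
Proof.
move=> t_ind; rewrite /facet_weight t_ind mul1r; congr (_ * _).
have -> : (zeros t == [set: 'I_n]%SET) =
    [forall i, 0 <= side t (p i)] && [forall i, side t (p i) <= 0].
  apply/eqP/andP => [zT|[/forallP ge0 /forallP le0]].
    have t0 i : side t (p i) = 0.
      apply/eqP; have : i \in zeros t by rewrite zT finset.in_setT.
      by rewrite inE.
    by split; apply/forallP => i; rewrite t0.
  by apply/setP => i; rewrite !inE; apply/eqP/le_anti; rewrite ge0 le0.
rewrite /one_sided; case: [forall i, 0 <= _]; case: [forall i, _ <= 0] => //=;
  by rewrite ?mul1r ?mul0r ?addr0 ?add0r.
Qed.

(** Group the tuples with a supporting hyperplane by that hyperplane: the inverse falling factorials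
    in a group add up to 1, doubled if the hyperplane contains all the points. Any injective [f0]
    detects this case, since it spans such a hyperplane if there is one. *)
Lemma num_facets_sum (f0 : {ffun 'I_d -> 'I_n}) : injectiveb f0 ->
  (num_facets p)%:R + (zeros (p \o f0) == [set: 'I_n]%SET)%:R =
  \sum_(f : {ffun 'I_d -> 'I_n} | injectiveb f) facet_weight (p \o f).
Proof.
move=> f0_inj.
pose facets := [set S | facet_index S]%SET.
have facetsP S : reflect (exists g : {ffun 'I_d -> 'I_n},
    [/\ injectiveb g, one_sided (p \o g) & S = zeros (p \o g)]) (S \in facets).
  rewrite inE; apply: (iffP existsP) => -[g].
    move=> /and3P [g_ind g_os /eqP SE]; exists g; split => //.
    apply/injectiveP => i j gij; apply/eqP/negPn/negP => ij.
    move: g_ind; rewrite /affinely_independent -/(lift_mx _) => free.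
    have : (delta_mx 0 i - delta_mx 0 j : 'rV[R]_d) *m lift_mx (p \o g) = 0.
      by rewrite mulmxBl -!rowE !rowK /= gij subrr.
    move/eqP; rewrite mulmx_free_eq0 // => /eqP /rowP /(_ i) /eqP.
    by rewrite !mxE !eqxx (negbTE ij) subr0 oner_eq0.
  by move=> [g_inj g_os SE]; exists g; rewrite p_gen // g_os SE eqxx.
have -> : (zeros (p \o f0) == [set: 'I_n]%SET) = ([set: 'I_n]%SET \in facets).
  apply/eqP/facetsP => [f0T|[g [g_inj _ gT]]].
    exists f0; split => //; apply/orP; left; apply/forallP => i.
    have : i \in zeros (p \o f0) by rewrite f0T inE.
    by rewrite inE => /eqP ->.
  by have [|->] := zeros_spanned f0_inj g_inj => // i; rewrite -gT inE.
rewrite num_facetsE // -/facets.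
transitivity (\sum_(S in facets) (1 + (S == [set: 'I_n]%SET)%:R) : R).
  rewrite big_split /= sumr_const; congr (_ + _).
  case: (boolP ([set: 'I_n]%SET \in facets)) => [inT|notT].
    rewrite (bigD1 [set: 'I_n]%SET) //= eqxx big1 ?addr0 // => S /andP [_ /negbTE ->] //.
  by rewrite big1 // => S SF; case: eqP => // ST; move: notT; rewrite -ST SF.
transitivity (\sum_(f : {ffun 'I_d -> 'I_n} | injectiveb f && one_sided (p \o f))
    facet_weight (p \o f)); last first.
  rewrite [RHS](bigID (fun f : {ffun 'I_d -> 'I_n} => one_sided (p \o f))) /=.
  rewrite [X in _ = _ + X]big1 ?addr0 // => f /andP [f_inj /negbTE f_os].
  by rewrite facet_weight_one_sided ?p_gen // f_os !mul0r.
rewrite [RHS](partition_big (fun f : {ffun 'I_d -> 'I_n} => zeros (p \o f))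
  (mem facets)) /=; last first.
  by move=> f /andP [f_inj f_os]; apply/facetsP; exists f.
apply: eq_bigr => S /facetsP [g [g_inj g_os ->]].
transitivity (\sum_(f in [set f : {ffun 'I_d -> 'I_n} |
       injectiveb f && (zeros (p \o f) == zeros (p \o g))]%SET)
   (1 + (zeros (p \o g) == [set: 'I_n]%SET)%:R) * ((#|zeros (p \o g)| ^_ d)%N%:R)^-1 : R).
  (* The falling factorial is nonzero: at least the d points of [g] lie on the hyperplane. *)
  rewrite sumr_const card_spanning // -[RHS]mulr_natr -mulrA mulVf ?mulr1 //.
  rewrite pnatr_eq0 -lt0n ffact_gt0 -[X in (X <= _)%N]card_ord.
  rewrite -(card_codom (injectiveP _ g_inj)); apply: subset_leq_card.
  by apply/fintype.subsetP => _ /codomP [i ->]; rewrite inE side_self.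
apply: eq_big => f.
  rewrite inE; case f_inj: (injectiveb f) => //=; case: eqP => [zE|_]; rewrite ?andbF //.
  have [|_ ->] := zeros_spanned f_inj g_inj; last by rewrite g_os.
  by move=> i; rewrite -zE inE side_self.
rewrite inE => /andP [f_inj /eqP zE].
rewrite facet_weight_one_sided ?p_gen // zE.
have [|_ ->] := zeros_spanned f_inj g_inj; last by rewrite g_os mul1r.
by move=> i; rewrite -zE inE side_self.
Qed.

End GeneralPosition.
End Configuration.
End Facets.

(** * Convexity of the weights *)

Section WeightConvexity.
Variable R : realType.

(** For [j < d] this is the inverse of 0, hence 0 by convention, which breaks monotonicity; this is
    why [d <= j] is assumed below. *)
Definition ffact_inv d j : R := ((j ^_ d)%N%:R)^-1.

Lemma ffact_invS d j : (d <= j)%N ->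
  ffact_inv d j.+1 = ffact_inv d j * ((j.+1 - d)%N%:R / j.+1%:R).
Proof.
move=> dj; rewrite /ffact_inv.
have fact0 i : i`!%:R != 0 :> R by rewrite pnatr_eq0 -lt0n fact_gt0.
have E i : (d <= i)%N -> ((i ^_ d)%N%:R : R) = i`!%:R / (i - d)`!%:R.
  by move=> di; rewrite -(ffact_fact di) natrM mulfK.
rewrite !E //; last exact: leqW.
rewrite subSn // !factS !natrM.
have j0 : j.+1%:R != 0 :> R by rewrite pnatr_eq0.
have jd0 : (j - d).+1%:R != 0 :> R by rewrite pnatr_eq0.
by field; rewrite !nat1r j0 jd0 !fact0.
Qed.

Lemma ffact_inv_ge0 d j : 0 <= ffact_inv d j.
Proof. by rewrite invr_ge0 ler0n. Qed.

Lemma ffact_inv_decr d j : (d <= j)%N -> ffact_inv d j.+1 <= ffact_inv d j.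
Proof.
move=> dj; rewrite ffact_invS // ler_piMr ?ffact_inv_ge0 //.
by rewrite ler_pdivrMr ?ltr0n // mul1r ler_nat leq_subr.
Qed.

Lemma ffact_inv_convex d j : (d <= j)%N ->
  2 * ffact_inv d j.+1 <= ffact_inv d j + ffact_inv d j.+2.
Proof.
move=> dj; rewrite (ffact_invS (leqW dj)) (ffact_invS dj).
have := ffact_inv_ge0 d j; set w := ffact_inv d j => w0.
rewrite (natrB _ (leqW dj)) (natrB _ (leqW (leqW dj))).
rewrite -[j.+2%:R]natr1 -[j.+1%:R]natr1 -subr_ge0.
have j0 : 0 <= j%:R :> R by []. have d0 : 0 <= d%:R :> R by [].
set J : R := j%:R in j0 *; set D : R := d%:R in d0 *.
have J1 : J + 1 != 0 by lra. have J2 : J + 1 + 1 != 0 by lra.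
have -> : w + w * ((J + 1 - D) / (J + 1)) * ((J + 1 + 1 - D) / (J + 1 + 1)) -
          2 * (w * ((J + 1 - D) / (J + 1))) =
          w * (D * (D + 1)) / ((J + 1) * (J + 1 + 1)).
  by field; rewrite J1 J2.
by rewrite divr_ge0 ?mulr_ge0 //; lra.
Qed.

Lemma lift_lift_max n (i : 'I_n) :
  lift (lift ord_max ord_max) (lift ord_max i) = lift ord_max (lift ord_max i) :> 'I_n.+2.
Proof. by apply: val_inj; rewrite /= /bump; have := ltn_ord i; lia. Qed.

Lemma forall_lift n (h : 'I_n.+1) (P : pred 'I_n.+1) :
  [forall i, P i] = [forall i, P (lift h i)] && P h.
Proof.
apply/forallP/andP => [Pi|[/forallP Pl Ph] i]; first by split=> //; apply/forallP.
by case: (unliftP h i) => [j ->|->].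
Qed.

Lemma card_lift n (h : 'I_n.+1) (P : pred 'I_n.+1) :
  #|[set i | P i]%SET| = (#|[set i | P (lift h i)]%SET| + P h)%N.
Proof.
rewrite -!sum1dep_card big_mkcond (bigD1_ord h) //= addnC -big_mkcond.
by case: (P h).
Qed.

Variable d : nat.

Lemma facet_weight_add n (p : 'I_n.+1 -> 'rV[R]_d) (h : 'I_n.+1) t :
  facet_weight p t = (affinely_independent t)%:R *
   (([forall i, 0 <= side t (p (lift h i))] && (0 <= side t (p h)))%:R +
    ([forall i, side t (p (lift h i)) <= 0] && (side t (p h) <= 0))%:R) *
   ffact_inv d (#|zeros (p \o lift h) t| + (side t (p h) == 0)).
Proof.
by rewrite /facet_weight /zeros (card_lift h) !(forall_lift h).
Qed.

(** The last two points are added to the others. For each of the two sides separately, a new point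
    keeps the weight, advances [ffact_inv d] by one step, or makes the weight 0. So the mixed second
    difference is 0, [w0], [w0 - w1] or [w0 - 2 * w1 + w2], up to the independence factor. *)
Lemma facet_weight_convex n (p : 'I_n.+2 -> 'rV[R]_d) (t : 'I_d -> 'rV[R]_d) :
  (d <= #|zeros (p \o lift ord_max \o lift ord_max) t|)%N ->
  facet_weight (p \o lift ord_max) t + facet_weight (p \o lift (lift ord_max ord_max)) t
  <= facet_weight (p \o lift ord_max \o lift ord_max) t + facet_weight p t.
Proof.
have swapE : p \o lift (lift ord_max ord_max) \o lift ord_max =
             p \o lift ord_max \o lift ord_max.
  by apply/funext => i; rewrite /= lift_lift_max.
have swap_max : lift (lift ord_max ord_max) (ord_max : 'I_n.+1) = ord_max :> 'I_n.+2.
  by apply: val_inj; rewrite /= /bump; lia.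
set p0 := p \o lift ord_max \o lift ord_max in swapE *.
pose g := [forall i, 0 <= side t (p0 i)]; pose l := [forall i, side t (p0 i) <= 0].
pose x := side t (p (lift ord_max ord_max)); pose y := side t (p ord_max).
set Z := #|zeros p0 t| => dZ; pose a : R := (affinely_independent t)%:R.
have E0 : facet_weight p0 t = a * (g%:R + l%:R) * ffact_inv d Z by [].
have add_p0 (q : 'I_n.+1 -> 'rV[R]_d) : q \o lift ord_max = p0 -> facet_weight q t =
    a * ((g && (0 <= side t (q ord_max)))%:R + (l && (side t (q ord_max) <= 0))%:R) *
    ffact_inv d (Z + (side t (q ord_max) == 0)).
  by move=> qE; rewrite /g /l /Z -qE; exact: facet_weight_add.
have E1 : facet_weight (p \o lift ord_max) t =
    a * ((g && (0 <= x))%:R + (l && (x <= 0))%:R) * ffact_inv d (Z + (x == 0)).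
  exact: add_p0.
have E2 : facet_weight (p \o lift (lift ord_max ord_max)) t =
    a * ((g && (0 <= y))%:R + (l && (y <= 0))%:R) * ffact_inv d (Z + (y == 0)).
  by rewrite (add_p0 _ swapE) /= swap_max.
have E3 : facet_weight p t =
    a * ((g && (0 <= x) && (0 <= y))%:R + (l && (x <= 0) && (y <= 0))%:R) *
    ffact_inv d (Z + (x == 0) + (y == 0)).
  rewrite (facet_weight_add p ord_max) /zeros (card_lift ord_max).
  rewrite (forall_lift ord_max).
  by rewrite (forall_lift ord_max (fun i => side t (p (lift ord_max i)) <= 0)).
rewrite E0 E1 E2 E3 -subr_ge0.
have := ffact_inv_ge0 d Z.+1; have := ffact_inv_decr dZ; have := ffact_inv_convex dZ.
have := ffact_inv_decr (leqW dZ).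
set w0 := ffact_inv d Z; set w1 := ffact_inv d Z.+1; set w2 := ffact_inv d Z.+2.
move=> w12 w012 w01 w1_ge0.
have w0_ge0 : 0 <= w0 by exact: le_trans w1_ge0 w01.
have nonneg (b : bool) (u : R) : 0 <= u -> 0 <= a * (b%:R * u).
  by move=> u0; rewrite !mulr_ge0.
have w01' : 0 <= w0 - w1 by rewrite subr_ge0.
have w012' : 0 <= w0 - w1 - (w1 - w2) by lra.
have := nonneg g _ w0_ge0; have := nonneg l _ w0_ge0.
have := nonneg g _ w01'; have := nonneg l _ w01'.
have := nonneg g _ w012'; have := nonneg l _ w012'.
case: (ltgtP 0 x) => _; case: (ltgtP 0 y) => _ /=;
  rewrite ?andbT ?andbF ?addn0 ?addn1 -/w0 -/w1 -/w2 ?mulr0n; lra.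
Qed.

Lemma facet_weight_ge0 n (p : 'I_n -> 'rV[R]_d) t : 0 <= facet_weight p t.
Proof. by rewrite !mulr_ge0 ?addr_ge0 ?invr_ge0. Qed.

Lemma facet_weight_le2 n (p : 'I_n -> 'rV[R]_d) t : facet_weight p t <= 2.
Proof.
have le1 (b : bool) : b%:R <= 1 :> R by case: b.
have inv1 k : (k%:R)^-1 <= 1 :> R.
  by case: k => [|k]; rewrite ?invr0 // invf_le1 ?ltr0n // ler1n.
rewrite -[2]mulr1 -[X in X * 1]mul1r ler_pM ?mulr_ge0 ?addr_ge0 ?invr_ge0 //.
by rewrite ler_pM ?addr_ge0 // (le_trans (lerD (le1 _) (le1 _))).
Qed.

Lemma zeros_reindex n (p : 'I_n -> 'rV[R]_d) (s : {perm 'I_n}) t :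
  zeros (p \o s) t = (s @^-1: zeros p t)%SET.
Proof. by apply/setP => i; rewrite !inE. Qed.

Lemma facet_weight_reindex n (p : 'I_n -> 'rV[R]_d) (s : {perm 'I_n}) t :
  facet_weight (p \o s) t = facet_weight p t.
Proof.
have forall_perm (b : pred 'I_n) : [forall i, b (s i)] = [forall i, b i].
  apply/forallP/forallP => bi i; last exact: bi.
  by rewrite -(permKV s i).
rewrite /facet_weight zeros_reindex card_preimset; last exact: perm_inj.
by rewrite (forall_perm (fun i => 0 <= side t (p i)))
           (forall_perm (fun i => side t (p i) <= 0)).
Qed.

End WeightConvexity.

(** The symmetric group on n letters is n-transitive, hence d-transitive for d <= n. *)
Lemma perm_extension d n (f g : 'I_d -> 'I_n) : injective f -> injective g ->
  exists s : {perm 'I_n}, forall i, s (f i) = g i.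
Proof.
move=> f_inj g_inj.
have dn : (d <= #|'I_n|)%N.
  by rewrite -[X in (X <= _)%N]card_ord -(card_codom f_inj) max_card.
have inD (h : 'I_d -> 'I_n) : injective h ->
    [tuple h i | i < d] \in dtuple_on d [set: 'I_n]%SET.
  move=> h_inj; apply/dtuple_onP; split=> [i j|i]; last by rewrite inE.
  by rewrite !tnth_mktuple => /h_inj.
have [s _ gs] := atransP2 (ntransitive_weak dn (@Sym_trans 'I_n)) (inD _ f_inj) (inD _ g_inj).
exists s => i; have := congr1 (fun t => tnth t i) gs.
by rewrite tnth_mktuple /n_act tnth_map tnth_mktuple => ->.
Qed.

Local Open Scope classical_set_scope.
Local Open Scope ring_scope.

(** * Convex sequences of regular growth *)

(** Each factor (N + i) / (N + 1) with i >= 1 is nonincreasing in N. *)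
Lemma ffact_ratio d M N : (M <= N)%N ->
  ((N + d) ^_ d * M.+1 ^ d <= (M + d) ^_ d * N.+1 ^ d)%N.
Proof.
move=> MN; elim: d => [|d IH]; first by rewrite !ffactn0.
rewrite !addnS !ffactSS !expnS.
have step : ((N + d).+1 * M.+1 <= (M + d).+1 * N.+1)%N by nia.
by rewrite mulnACA [X in (_ <= X)%N]mulnACA leq_mul.
Qed.

(** By convexity decrements do not increase, so the last one is at most the mean of the q before
    it. *)
Lemma convex_slope (R : realType) (h : nat -> R) :
  (forall N, 2 * h N.+1 <= h N + h N.+2) ->
  forall M q, q%:R * (h (M + q)%N - h (M + q).+1) <= h M - h (M + q)%N.
Proof.
move=> hconv M; elim=> [|q IH]; first by rewrite mul0r addn0 subrr.
rewrite addnS -natr1; have q0 : 0 <= q%:R :> R by [].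
have := hconv (M + q)%N; nra.
Qed.

Lemma divn_ratio_cvg (R : realType) k : (0 < k)%N ->
  (fun N : nat => (N %/ k)%N%:R / N.+1%:R : R) @ \oo --> (k%:R^-1 : R).
Proof.
move=> k0; have k0' : 0 < k%:R :> R by rewrite ltr0n.
apply: (@squeeze_cvgr _ _ _ _ (fun N : nat => k%:R^-1 - N.+1%:R^-1 : R)
                              (fun=> k%:R^-1)); last 2 first.
- rewrite -[X in _ --> X]subr0; apply: cvgB; first exact: cvg_cst.
  exact: cvg_harmonic.
- exact: cvg_cst.
apply: nearW => N.
have N0 : 0 < N.+1%:R :> R by rewrite ltr0n.
have Nk : N%:R = (N %/ k)%N%:R * k%:R + (N %% k)%N%:R :> R.
  by rewrite -natrM -natrD -divn_eq.
have mk : (N %% k)%N%:R + 1 <= k%:R :> R by rewrite natr1 ler_nat ltn_mod.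
have m0 : 0 <= (N %% k)%N%:R :> R by [].
rewrite ler_pdivlMr // ler_pdivrMr // -(ler_pM2r k0') -[X in _ && X](ler_pM2r k0').
rewrite -[N.+1%:R]natr1 in N0 *.
set q : R := (N %/ k)%N%:R in Nk *.
have -> : (k%:R^-1 - (N%:R + 1)^-1) * (N%:R + 1) * k%:R = N%:R + 1 - k%:R :> R.
  by field; rewrite !gt_eqF.
have -> : k%:R^-1 * (N%:R + 1) * k%:R = N%:R + 1 :> R by field; rewrite gt_eqF.
by apply/andP; split; lra.
Qed.

Lemma bernoulli_sub (R : realType) d (r : R) : 0 <= r <= 1 -> 1 - d%:R * r <= (1 - r) ^+ d.
Proof.
move=> /andP [r0 r1]; elim: d => [|d IH]; first by rewrite mul0r subr0 expr0.
have d0 : 0 <= d%:R :> R by [].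
rewrite exprSr -natr1; apply: (@le_trans _ _ ((1 - d%:R * r) * (1 - r))); first nra.
by rewrite ler_wpM2r // subr_ge0.
Qed.

(** From [1 - s <= exp (- s)] and [1 + c * s <= exp (c * s)]. *)
Lemma powR_sub_le (R : realType) (c s : R) : 0 <= c -> 0 <= s -> s < 1 ->
  (1 - s) `^ c * (1 + c * s) <= 1.
Proof.
move=> c0 s0 s1; have s1' : 0 < 1 - s by lra.
have lnle : ln (1 - s) <= - s.
  by have := @le_ln1Dx R (- s); rewrite ltrN2 => /(_ s1).
rewrite /powR gt_eqF // -[X in _ <= X](expRxMexpNx_1 (c * s)) [X in X <= _]mulrC.
apply: ler_pM; rewrite ?expR_ge0 ?addr_ge0 ?mulr_ge0 //; first exact: expR_ge1Dx.
by rewrite ler_expR -mulrN ler_wpM2l.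
Qed.

(** With e = 1 / k the product is 1 + e (c - d^2 (1 + c e) e), and the bracket is positive once k >
    d^2 (1 + c) / c. It is the limit of the factor in the last hypothesis of [step_increase]. *)
Lemma step_limit_gt1 (R : realType) (d : nat) (c : R) : 0 < c ->
  exists2 k : nat, (1 < k)%N &
    1 < (1 + c * k%:R^-1) * (1 + d%:R * k%:R^-1) * (1 - d%:R * k%:R^-1) :> R.
Proof.
move=> c0; pose x : R := d%:R ^+ 2 * (1 + c) / c.
exists (Num.truncn x).+2 => //; set K := (Num.truncn x).+2.
have xK : x < K%:R by apply: lt_trans (truncnS_gt x) _; rewrite ltr_nat.
have K1 : 1 < K%:R :> R by rewrite ltr1n.
have K0 : 0 < K%:R :> R by lra.
set e : R := K%:R^-1.
have e0 : 0 < e by rewrite invr_gt0.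
have e1 : e <= 1 by rewrite invf_le1 // ltW.
have de : d%:R ^+ 2 * (1 + c) * e < c.
  by rewrite /e ltr_pdivrMr // [X in _ < X]mulrC -ltr_pdivrMr.
have d0 : 0 <= d%:R ^+ 2 :> R by rewrite exprn_ge0.
rewrite -mulrA -[X in _ * X]mulrC -subr_sqr expr1n exprMn -subr_gt0.
have -> : (1 + c * e) * (1 - d%:R ^+ 2 * e ^+ 2) - 1 =
    e * (c - d%:R ^+ 2 * (1 + c * e) * e) by ring.
rewrite mulr_gt0 // subr_gt0; apply: le_lt_trans de.
apply: ler_wpM2r; first exact: ltW.
by apply: ler_wpM2l => //; rewrite lerD2l ler_piMr // ltW.
Qed.

Section EventuallyIncreasing.
Variables (R : realType) (d : nat) (h : nat -> R) (A c : R).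
Hypotheses (A_gt0 : 0 < A) (c_gt0 : 0 < c).
Hypothesis h_convex : forall N, 2 * h N.+1 <= h N + h N.+2.

(** The index is shifted: [N] stands for a sample of N + d points. Thus [F N] counts the injective
    d-tuples and is never 0; [g] compares [F N * h N] with its asymptotic form. *)
Let F N : R := ((N + d) ^_ d)%N%:R.
Let g N := F N * h N / (A * (N + d)%N%:R `^ c).

Hypothesis g_cvg : g @ \oo --> (1 : R).

Let F_gt0 N : 0 < F N.
Proof. by rewrite ltr0n ffact_gt0 leq_addl. Qed.

Let FS N : F N.+1 * N.+1%:R = (N + d).+1%:R * F N.
Proof.
rewrite /F -!natrM addSn -ffactSS ffactnSr; congr (_ * _)%N%:R.
by rewrite -addSn addnK.
Qed.

Let h_g N : (0 < N)%N -> h N = g N * (A * (N + d)%N%:R `^ c) / F N.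
Proof.
move=> N0; have n0 : 0 < (N + d)%N%:R :> R by rewrite ltr0n addn_gt0 N0.
have := powR_gt0 c n0; rewrite /g; have := F_gt0 N.
move: (F N) (_ `^ c) => u v u0 v0.
by field; rewrite !gt_eqF.
Qed.

(** The decrement of [h] at [N = M + q] is at most the mean one over the q steps from [M], which
    [h_g] expresses through [g], the power and [F] at both ends. The three factors are a lower bound
    for the growth of the power from [M] to [N], an admissible bound for [h M / h N], and a lower
    bound for [F M / F N]. *)
Lemma step_increase (M q : nat) (r t : R) : (0 < M)%N -> (0 < q)%N ->
  r = q%:R / (M + q).+1%:R -> t = q%:R / (M + q + d).+1%:R ->
  0 < g (M + q)%N -> 0 < g M -> 0 < 1 - d%:R * r ->
  g M < g (M + q)%N * ((1 + c * t) * (1 + d%:R * t) * (1 - d%:R * r)) ->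
  F (M + q)%N * h (M + q)%N < F (M + q).+1 * h (M + q).+1.
Proof.
set N := (M + q)%N => M0 q0 rE tE gN gM dr gMN.
have N0 : (0 < N)%N by rewrite addn_gt0 M0.
have qN : (q < N)%N by rewrite -[X in (X < _)%N]add0n ltn_add2r.
have qNd : (q < N + d)%N by exact: ltn_addr.
have subd : (M + d = N + d - q)%N by rewrite /N addnAC addnK.
have subS : (M.+1 = N.+1 - q)%N by rewrite /N -addSn addnK.
have N1 : 0 < N.+1%:R :> R by []. have n1 : 0 < (N + d).+1%:R :> R by [].
have nN : (N + d).+1%:R = N.+1%:R + d%:R :> R by rewrite -natrD.
have n0 : 0 < (N + d)%N%:R :> R by rewrite ltr0n addn_gt0 N0.
(* By [FS], passing from [F N] to [F N.+1] multiplies by (N + d + 1) / (N + 1). *)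
suff : N.+1%:R * h N < (N + d).+1%:R * h N.+1.
  move=> lt; rewrite -(ltr_pM2r N1) [X in _ < X]mulrAC FS.
  rewrite -mulrA [h N * _]mulrC [(N + d).+1%:R * F N]mulrC -[X in _ < X]mulrA.
  by rewrite ltr_pM2l ?F_gt0.
have hN : 0 < h N.
  by rewrite h_g // divr_gt0 ?F_gt0 // mulr_gt0 // mulr_gt0 // powR_gt0.
have qR : 0 < q%:R :> R by rewrite ltr0n.
(* As [t] times N + d + 1 is q, convexity then gives [(N + d + 1) * (h N - h N.+1) < d * h N], a
   rearrangement of the goal. *)
suff hM_lt : h M < h N * (1 + d%:R * t).
  have := convex_slope h_convex M q; rewrite -/N => slope.
  have tn : t * (N + d).+1%:R = q%:R by rewrite tE mulfVK // gt_eqF.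
  rewrite nN -subr_gt0 -(pmulr_rgt0 _ qR).
  have : (N + d).+1%:R * (h M - h N) < (N + d).+1%:R * (h N * (d%:R * t)).
    by rewrite ltr_pM2l // ltrBlDl -[X in X + _]mulr1 -mulrDr.
  have : (N + d).+1%:R * (q%:R * (h N - h N.+1)) <= (N + d).+1%:R * (h M - h N).
    by rewrite ler_pM2l.
  have -> : (N + d).+1%:R * (h N * (d%:R * t)) = q%:R * (d%:R * h N) by rewrite -tn; ring.
  by rewrite nN; lra.
(* The exact relative decrease, [M + d = (N + d) * (1 - s)]; it dominates [t]. *)
pose s : R := q%:R / (N + d)%N%:R.
have r0 : 0 <= r by rewrite rE divr_ge0.
have r1 : r <= 1 by rewrite rE ler_pdivrMr // mul1r ler_nat ltnW // ltnS ltnW.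
have s0 : 0 <= s by rewrite divr_ge0.
have s1 : s < 1 by rewrite ltr_pdivrMr // mul1r ltr_nat.
have ts : t <= s.
  by rewrite tE ler_pM2l // lef_pV2 ?posrE // ler_nat.
have t0 : 0 <= t by rewrite tE divr_ge0.
have mE : (M + d)%N%:R = (N + d)%N%:R * (1 - s) :> R.
  by rewrite mulrBr mulr1 [_ * s]mulrC mulfVK ?gt_eqF // subd natrB ?(ltnW qNd).
have powM : (M + d)%N%:R `^ c * (1 + c * s) <= (N + d)%N%:R `^ c.
  rewrite mE powRM ?subr_ge0 ?(ltW s1) // -mulrA ler_piMr ?powR_ge0 //.
  by rewrite powR_sub_le // ltW.
(* Here 1 - r = (M + 1) / (N + 1), so [ffact_ratio] and Bernoulli's inequality apply. *)
have FM : F N * (1 - d%:R * r) <= F M.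
  have M1 : 1 - r = M.+1%:R / N.+1%:R.
    by rewrite rE subS natrB ?(leqW (ltnW qN)) // mulrBl mulfV // gt_eqF.
  apply: (@le_trans _ _ (F N * (1 - r) ^+ d)).
    by rewrite ler_pM2l // bernoulli_sub // r0.
  rewrite M1 expr_div_n mulrA ler_pdivrMr ?exprn_gt0 //.
  by rewrite -!natrX -!natrM ler_nat ffact_ratio // /N leq_addr.
have cs : 0 < 1 + c * s by rewrite ltr_wpDr // mulr_ge0 // ltW.
have Nc : 0 < A * (N + d)%N%:R `^ c by rewrite mulr_gt0 // powR_gt0.
rewrite (h_g M0) (h_g N0) ltr_pdivrMr //.
apply: (@le_lt_trans _ _ (g M * (A * (N + d)%N%:R `^ c) / (1 + c * s))).
  by rewrite ler_pdivlMr // -[X in X <= _]mulrA ler_pM2l // -mulrA ler_pM2l.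
rewrite ltr_pdivrMr //; set B := A * _ in Nc *.
have dt : 0 < 1 + d%:R * t by rewrite ltr_wpDr // mulr_ge0.
apply: (@lt_le_trans _ _
  (g N * ((1 + c * t) * (1 + d%:R * t) * (1 - d%:R * r)) * B)).
  by rewrite ltr_pM2r.
have -> : g N * B / F N * (1 + d%:R * t) * F M * (1 + c * s) =
    g N * ((1 + c * s) * (1 + d%:R * t) * (F M / F N)) * B by ring.
rewrite ler_pM2r // ler_pM2l //; apply: ler_pM.
- by rewrite mulr_ge0 // ?addr_ge0 ?mulr_ge0 // ltW.
- exact: ltW.
- by rewrite ler_pM2r // lerD2l ler_pM2l.
- by rewrite ler_pdivlMr ?F_gt0 // mulrC.
Qed.

(** Take [q = N %/ k] with k from [step_limit_gt1]: as [g] tends to 1 at both ends, the condition of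
    [step_increase] holds in the limit with room to spare. *)
Lemma eventually_increasing :
  exists N0, forall N, (N0 <= N)%N -> F N * h N < F N.+1 * h N.+1.
Proof.
have [k k1] := @step_limit_gt1 R d c c_gt0; set e : R := k%:R^-1 => lim_gt1.
have k0 : (0 < k)%N by exact: ltnW.
pose q N := (N %/ k)%N; pose M N := (N - q N)%N.
pose r N : R := (q N)%:R / N.+1%:R.
(* A lower bound for the [t] of [step_increase], used in its place because its limit 1 / k follows
   from that of [r]. *)
pose u N : R := r N * (1 - d%:R * N.+1%:R^-1).
have r_cvg : r @ \oo --> (e : R) by exact: divn_ratio_cvg.
have u_cvg : u @ \oo --> (e : R).
  rewrite -[e]mulr1 -[X in e * X]subr0 -[X in e * (1 - X)](mulr0 d%:R).
  apply: cvgM => //; apply: cvgB; first exact: cvg_cst.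
  by apply: cvgM; [exact: cvg_cst|exact: cvg_harmonic].
(* Since k >= 2, at least half of N remains. *)
have M_cvg : M @ \oo --> \oo.
  apply/cvgnyPge => a; near=> N; have : (a.*2 <= N)%N by near: N; exact: nbhs_infty_ge.
  rewrite /M /q => aN; have : (N %/ k <= N %/ 2)%N by exact: leq_div2l.
  have := leq_trunc_div N 2; lia.
have gM_cvg : (g \o M) @ \oo --> (1 : R) by exact: cvg_comp M_cvg g_cvg.
pose phi N : R := g N * ((1 + c * u N) * (1 + d%:R * u N) * (1 - d%:R * r N)) - g (M N).
have lin a (b : nat -> R) : b @ \oo --> e -> (fun N => 1 + a * b N) @ \oo --> 1 + a * e.
  by move=> bc; apply: cvgD; [exact: cvg_cst|apply: cvgM => //; exact: cvg_cst].
have dr_cvg : (fun N => 1 - d%:R * r N) @ \oo --> 1 - d%:R * e.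
  by apply: cvgB; [exact: cvg_cst|apply: cvgM => //; exact: cvg_cst].
have phi_cvg : phi @ \oo --> 1 * ((1 + c * e) * (1 + d%:R * e) * (1 - d%:R * e)) - 1.
  apply: cvgB => //; apply: cvgM => //; apply: cvgM => //.
  by apply: cvgM; exact: lin.
have e0 : 0 < e by rewrite invr_gt0 ltr0n.
(* Otherwise the product in [lim_gt1] would be at most 0. *)
have de : 0 < 1 - d%:R * e.
  rewrite ltNge; apply/negP => le0; have := lt_trans ltr01 lim_gt1.
  apply/negP; rewrite -leNgt; apply: mulr_ge0_le0 => //.
  by rewrite mulr_ge0 ?addr_ge0 ?mulr_ge0 // ltW.
have : \forall N \near \oo, F N * h N < F N.+1 * h N.+1.
  near=> N.
  have kN : (k <= N)%N by near: N; exact: nbhs_infty_ge.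
  have qN : (q N <= N)%N by exact: leq_div.
  have MqN : (M N + q N)%N = N by rewrite subnK.
  pose t : R := (q N)%:R / (N + d).+1%:R.
  have u0 : 0 < u N.
    by near: N; exact: cvgr_gt u_cvg _ e0.
  have gM0 : 0 < g (M N) by near: N; exact: cvgr_gt gM_cvg _ ltr01.
  have gN0 : 0 < g N by near: N; exact: cvgr_gt g_cvg _ ltr01.
  have dr0 : 0 < 1 - d%:R * r N by near: N; exact: cvgr_gt dr_cvg _ de.
  have phi0 : 0 < phi N.
    by near: N; apply: cvgr_gt phi_cvg _ _; rewrite mul1r subr_gt0.
  have ut : u N <= t.
    rewrite /u /t /r -mulrA ler_wpM2l //.
    have N1 : 0 < N.+1%:R :> R by [].
    have n1 : 0 < (N + d).+1%:R :> R by [].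
    rewrite -[X in _ <= X]mul1r ler_pdivlMr //.
    have -> : (N + d).+1%:R = N.+1%:R + d%:R :> R by rewrite -natrD.
    rewrite -(ler_pM2r N1) -(ler_pM2r N1).
    have -> : N.+1%:R^-1 * (1 - d%:R / N.+1%:R) * (N.+1%:R + d%:R) * N.+1%:R * N.+1%:R
       = N.+1%:R * N.+1%:R - d%:R * d%:R :> R by field; rewrite gt_eqF.
    by rewrite mul1r gerBl mulr_ge0.
  have := @step_increase (M N) (q N) (r N) t; rewrite MqN; apply => //.
  - by rewrite subn_gt0 ltn_Pdiv // (leq_trans k0).
  - by rewrite divn_gt0.
  rewrite -subr_gt0; apply: lt_le_trans phi0 _; rewrite lerD2r ler_pM2l // ler_pM2r //.
  apply: ler_pM.
  - by rewrite addr_ge0 // mulr_ge0 // ltW.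
  - by rewrite addr_ge0 // mulr_ge0 // ltW.
  - by rewrite lerD2l ler_pM2l.
  - by rewrite lerD2l; apply: ler_wpM2l.
by move=> [N0 _ HN0]; exists N0 => N; exact: HN0.
Unshelve. all: by end_near.
Qed.

End EventuallyIncreasing.

(** * Subsamples of i.i.d. samples *)

Section Sampling.
Variables (R : realType) (d : measure_display) (T : measurableType d).

Definition subsample m n (s : 'I_m -> 'I_n) (x : n.-tuple T) : m.-tuple T :=
  [tuple tnth x (s i) | i < m].

Lemma measurable_subsample m n (s : 'I_m -> 'I_n) :
  measurable_fun setT (subsample s).
Proof.
apply/measurable_fun_tnthP => i.
apply: (eq_measurable_fun (fun x : n.-tuple T => tnth x (s i))).
  by move=> x _ /=; rewrite tnth_mktuple.
exact: measurable_tnth.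
Qed.

Definition box n (A : 'I_n -> set T) : set (n.-tuple T) :=
  [set x | forall i, A i (tnth x i)].

Definition boxes n : set (set (n.-tuple T)) :=
  [set B | exists2 A, (forall i, measurable (A i)) & B = box A].

Lemma measurable_box n (A : 'I_n -> set T) :
  (forall i, measurable (A i)) -> measurable (box A).
Proof.
move=> mA; rewrite (_ : box A = \bigcap_(i in [set: 'I_n])
  ((fun x : n.-tuple T => tnth x i) @^-1` A i)).
  apply: fin_bigcap_measurable => // i _.
  by rewrite -[X in measurable X]setTI; exact: measurable_tnth.
by apply/seteqP; split => x Ax i => [_|]; apply: Ax.
Qed.

Lemma measurable_boxes n : @measurable _ (n.-tuple T) = <<s @boxes n >>.
Proof.
apply/seteqP; split; last first.
  apply: smallest_sub; first exact: sigma_algebra_measurable.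
  by move=> _ [A mA ->]; exact: measurable_box.
apply: smallest_sub; first exact: smallest_sigma_algebra.
move=> B; rewrite -bigcup_seq => -[i _ [A mA <-]]; apply: sub_sigma_algebra.
exists (fun j => if j == i then A else setT).
  by move=> j; case: ifP.
rewrite setTI; apply/seteqP; split => x /=.
  by move=> Axi j; case: eqP => [->|].
by move=> /(_ i); rewrite eqxx.
Qed.

(** The boxes are stable under intersection, generate the sigma-algebra and include the whole space,
    so they determine a finite measure. *)
Lemma eq_measure_boxes n (m1 m2 : {measure set (n.-tuple T) -> \bar R}) :
  (m1 setT < +oo)%E ->
  (forall A : 'I_n -> set T, (forall i, measurable (A i)) -> m1 (box A) = m2 (box A)) ->
  forall B, measurable B -> m1 B = m2 B.
Proof.
move=> m1oo m12; apply: (measure_unique (@boxes n) (fun=> setT)) => //.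
- exact: measurable_boxes.
- move=> _ _ [A mA ->] [B mB ->]; exists (fun i => A i `&` B i).
    by move=> i; exact: measurableI.
  apply/seteqP; split => x /=; first by move=> [Ax Bx] i; split.
  by move=> ABx; split => i; have [] := ABx i.
- move=> _; exists (fun=> setT) => //.
  by apply/seteqP; split => x //= _ i.
- by apply/seteqP; split => x // _; exists 0%N.
- by move=> _ [A mA ->]; exact: m12.
Qed.

End Sampling.

Section IidSubsample.
Variables (R : realType) (d : nat) (P : probability (d.-tuple R) R).
Variables (m n : nat) (Qm : probability (m.-tuple (d.-tuple R)) R).
Variable Qn : probability (n.-tuple (d.-tuple R)) R.
Hypotheses (iid_m : iid_law P Qm) (iid_n : iid_law P Qn).
Variable s : 'I_m -> 'I_n.
Hypothesis s_inj : injective s.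

Let ms := @measurable_subsample _ (d.-tuple R) m n s.

(** The preimage of a box is a box with full sides outside the image of [s]; these contribute
    factors 1, and the boxes determine the law. *)
Lemma subsample_law (B : set (m.-tuple (d.-tuple R))) : measurable B ->
  Qn (subsample s @^-1` B) = Qm B.
Proof.
move=> mB.
pose mu' : {measure set (m.-tuple (d.-tuple R)) -> \bar R} :=
  pushforward Qn (subsample s).
pose mu := mu' ms.
rewrite -[LHS]/(mu B); apply: (@eq_measure_boxes R _ _ _ mu Qm) mB.
  rewrite /mu /= /pushforward preimage_setT.
  by apply: le_lt_trans (probability_le1 _ _) _; rewrite ?ltry.
move=> A mA; rewrite [RHS](iid_m mA) -[LHS]/(Qn (subsample s @^-1` box A)).
pose A' j := if [pick i | s i == j] is Some i then A i else setT.
rewrite (_ : _ @^-1` _ = [set x | forall j, A' j (tnth x j)]).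
  rewrite iid_n; last by move=> j; rewrite /A'; case: pickP.
  rewrite (bigID (fun j => j \in codom s)) /= [X in (_ * X)%E]big1; last first.
    move=> j; rewrite /A'; case: pickP => [i /eqP <-|_ _]; first by rewrite codom_f.
    exact: probability_setT.
  rewrite mule1 -big_uniq; last exact/injectiveP.
  rewrite /codom /image_mem big_map big_enum /=.
  apply: eq_bigr => i _; rewrite /A'; case: pickP => [k /eqP /s_inj ->|/(_ i)] //.
  by rewrite eqxx.
apply/seteqP; split => x /= Ax.
  move=> j; rewrite /A'; case: pickP => // i /eqP <-.
  by have := Ax i; rewrite tnth_mktuple.
move=> i; rewrite tnth_mktuple; have := Ax (s i); rewrite /A'.
by case: pickP => [k /eqP /s_inj ->|/(_ i)] //; rewrite eqxx.
Qed.

Lemma integral_subsample (g : m.-tuple (d.-tuple R) -> \bar R) :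
  measurable_fun [set: m.-tuple (d.-tuple R)] g -> (forall x, 0 <= g x)%E ->
  (\int[Qn]_x g (subsample s x) = \int[Qm]_x g x)%E.
Proof.
move=> mg g0.
pose mu' : {measure set (m.-tuple (d.-tuple R)) -> \bar R} :=
  pushforward Qn (subsample s).
pose mu := mu' ms.
rewrite [RHS](eq_measure_integral mu); first by rewrite ge0_integral_pushforward.
by move=> B mB _; rewrite -[RHS]/(Qn (subsample s @^-1` B)) subsample_law.
Qed.

End IidSubsample.

(** * Measurability *)

(** The finitely many tests cut [T] into finitely many measurable cells on which [u] is constant, so
    every preimage under [u] is a finite union of cells. *)
Lemma measurable_bool_factor (dT dU : measure_display) (T : measurableType dT)
    (U : measurableType dU) (I : finType) (b : I -> T -> bool) (u : T -> U) :
  (forall i, measurable_fun [set: T] (b i)) ->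
  (forall x y, (forall i, b i x = b i y) -> u x = u y) -> measurable_fun [set: T] u.
Proof.
move=> mb bu _ Y mY; rewrite setTI.
pose g x := [ffun i => b i x].
rewrite (_ : u @^-1` Y = \bigcup_(v in g @` (u @^-1` Y)) (g @^-1` [set v])).
  apply: fin_bigcup_measurable => [|v _]; first exact: finite_finset.
  rewrite (_ : g @^-1` _ = \bigcap_(i in [set: I]) (b i @^-1` [set v i])).
    apply: fin_bigcap_measurable => [|i _]; first exact: finite_finset.
    by rewrite -[X in measurable X]setTI; exact: mb.
  apply/seteqP; split => x /=; first by move=> <- i _ /=; rewrite ffunE.
  by move=> bv; apply/ffunP => i; rewrite ffunE; exact: bv.
apply/seteqP; split => x /=.
  by move=> Yx; exists (g x) => //; exists x.
move=> [v [y Yy <-] /ffunP gxy]; rewrite /preimage /= (bu x y) // => i.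
by have := gxy i; rewrite !ffunE.
Qed.

Lemma measurable_det (dT : measure_display) (T : measurableType dT) (R : realType)
    m (M : T -> 'M[R]_m) :
  (forall i j, measurable_fun [set: T] (fun x => M x i j)) ->
  measurable_fun [set: T] (fun x => \det (M x)).
Proof.
move=> mM; apply: measurable_sum => s; apply: measurable_funM => //.
by apply: measurable_prod => i _.
Qed.

Section OrderType.
Variables (R : realType) (d n : nat).
Implicit Types (x y : n.-tuple (d.-tuple R)) (f : {ffun 'I_d -> 'I_n}).

Definition pts x : 'I_n -> 'rV[R]_d := fun i => pt (tnth x i).

(** Independence is recorded separately: when the whole sample lies in one hyperplane all the sides
    vanish, whatever the tuple. *)
Definition same_order_type x y := forall f,
  affinely_independent (pts x \o f) = affinely_independent (pts y \o f) /\
  forall i,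
    (0 <= side (pts x \o f) (pts x i)) = (0 <= side (pts y \o f) (pts y i)) /\
    (side (pts x \o f) (pts x i) <= 0) = (side (pts y \o f) (pts y i) <= 0).

Lemma measurable_lift1 (i : 'I_n) k :
  measurable_fun [set: n.-tuple (d.-tuple R)] (fun x => lift1 (pts x i) 0 k).
Proof.
rewrite /lift1 /pts /pt; case: (split_ordP k) => j ->.
  under eq_fun do rewrite row_mxEl mxE.
  exact: (measurableT_comp (measurable_tnth j) (measurable_tnth i)).
under eq_fun do rewrite row_mxEr mxE.
exact: measurable_cst.
Qed.

Lemma measurable_normal f k :
  measurable_fun [set: n.-tuple (d.-tuple R)]
    (fun x => normal_mx (lift_mx (pts x \o f)) k 0).
Proof.
under eq_fun do rewrite mxE.
apply: measurable_det => i j; case: (split_ordP i) => i' ->.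
  under eq_fun do rewrite col_mxEu mxE.
  exact: measurable_lift1.
under eq_fun do rewrite col_mxEd mxE.
exact: measurable_cst.
Qed.

Lemma measurable_side f i :
  measurable_fun [set: n.-tuple (d.-tuple R)]
    (fun x => side (pts x \o f) (pts x i)).
Proof.
under eq_fun do rewrite /side mxE.
apply: measurable_sum => k; apply: measurable_funM; first exact: measurable_lift1.
exact: measurable_normal.
Qed.

Lemma measurable_order_type (dU : measure_display) (U : measurableType dU)
    (u : n.-tuple (d.-tuple R) -> U) :
  (forall x y, same_order_type x y -> u x = u y) ->
  measurable_fun [set: n.-tuple (d.-tuple R)] u.
Proof.
move=> uE.
(* Two inequalities for each point, and the vanishing of each coordinate of the normal vector, which
   decides independence. *)
pose b (a : {ffun 'I_d -> 'I_n} * ('I_n + 'I_n + 'I_(d + 1)))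
       (x : n.-tuple (d.-tuple R)) : bool :=
  let: (f, c) := a in match c with
  | inl (inl i) => 0 <= side (pts x \o f) (pts x i)
  | inl (inr i) => side (pts x \o f) (pts x i) <= 0
  | inr k => normal_mx (lift_mx (pts x \o f)) k 0 == 0
  end.
apply: (@measurable_bool_factor _ _ _ _ _ b) => [[f [[i|i]|k]]|x y bxy] /=.
- by apply: measurable_fun_ler => //; exact: measurable_side.
- by apply: measurable_fun_ler => //; exact: measurable_side.
- apply: (measurable_fun_eqr (measurable_normal f k)).
  exact: measurable_cst.
apply: uE => f; split; last first.
  by move=> i; split; [have := bxy (f, inl (inl i))|have := bxy (f, inl (inr i))].
rewrite !affinely_independent_normal; congr (~~ _).
have nE k : (normal_mx (lift_mx (pts x \o f)) k 0 == 0) =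
            (normal_mx (lift_mx (pts y \o f)) k 0 == 0) := bxy (f, inr k).
apply/eqP/eqP => n0; apply/matrixP => k j; rewrite !ord1 [RHS]mxE; apply/eqP.
  by rewrite -nE n0 mxE.
by rewrite nE n0 mxE.
Qed.

Lemma same_order_type_zeros x y f : same_order_type x y ->
  zeros (pts x) (pts x \o f) = zeros (pts y) (pts y \o f).
Proof.
move=> xy; apply/setP => i; rewrite !inE !eq_le.
by have [_ /(_ i) [-> ->]] := xy f.
Qed.

Lemma same_order_type_nonneg x y f : same_order_type x y ->
  [forall i, 0 <= side (pts x \o f) (pts x i)] =
  [forall i, 0 <= side (pts y \o f) (pts y i)].
Proof. by move=> xy; apply: eq_forallb => i; have [_ /(_ i) [-> _]] := xy f. Qed.

Lemma same_order_type_nonpos x y f : same_order_type x y ->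
  [forall i, side (pts x \o f) (pts x i) <= 0] =
  [forall i, side (pts y \o f) (pts y i) <= 0].
Proof. by move=> xy; apply: eq_forallb => i; have [_ /(_ i) [_ ->]] := xy f. Qed.

Lemma measurable_facet_weight f :
  measurable_fun [set: n.-tuple (d.-tuple R)]
    (fun x => facet_weight (pts x) (pts x \o f)).
Proof.
apply: measurable_order_type => x y xy.
rewrite /facet_weight (same_order_type_zeros f xy) (same_order_type_nonneg f xy).
by rewrite (same_order_type_nonpos f xy) (xy f).1.
Qed.

Lemma measurable_all_zeros f :
  measurable_fun [set: n.-tuple (d.-tuple R)]
    (fun x => (zeros (pts x) (pts x \o f) == [set: 'I_n]%SET)%:R : R).
Proof.
by apply: measurable_order_type => x y xy; rewrite (same_order_type_zeros f xy).
Qed.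

Lemma measurable_num_facets : (0 < d)%N ->
  measurable_fun [set: n.-tuple (d.-tuple R)] (fun x => (num_facets (pts x))%:R : R).
Proof.
move=> d0; apply: measurable_order_type => x y xy.
have index_eq : facet_index (pts x) =1 facet_index (pts y).
  move=> S; apply: eq_existsb => f.
  rewrite /one_sided (same_order_type_zeros f xy) (same_order_type_nonneg f xy).
  by rewrite (same_order_type_nonpos f xy) (xy f).1.
rewrite (num_facetsE (pts x) d0) (num_facetsE (pts y) d0); congr _%:R.
by apply: eq_card => S; rewrite [LHS]finset.in_set [RHS]finset.in_set index_eq.
Qed.

End OrderType.

(** * Expectations *)

Lemma powR_cvgy (R : realType) (c : R) (a : nat) : 0 < c ->
  (fun N : nat => (N + a)%N%:R `^ c) @ \oo --> +oo.
Proof.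
move=> c0; apply/cvgryPge => B; near=> N.
pose B' := Num.max B 0; have B'0 : 0 <= B' by rewrite le_max lexx orbT.
have : B' `^ c^-1 <= N%:R by near: N; exact: nbhs_infty_ger.
move=> BN; apply: (@le_trans _ _ B'); first by rewrite le_max lexx.
have B'E : (B' `^ c^-1) `^ c = B' by rewrite -powRrM mulVf ?lt0r_neq0 // powRr1.
rewrite -[X in X <= _]B'E.
apply: ge0_ler_powR; rewrite ?nnegrE ?powR_ge0 ?(ltW c0) //.
by apply: (le_trans BN); rewrite ler_nat leq_addr.
Unshelve. all: by end_near.
Qed.

Section ExpectedFacets.
Variables (R : realType) (d : nat) (d_gt0 : (0 < d)%N).
Variables (P : probability (d.-tuple R) R).
Variable Q : forall n : nat, probability (n.-tuple (d.-tuple R)) R.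
Hypothesis hQ : forall n : nat, iid_law P (Q n).

Lemma pts_subsample m n (s : 'I_m -> 'I_n) (x : n.-tuple (d.-tuple R)) :
  pts (subsample s x) = pts x \o s.
Proof. by apply/funext => i; rewrite /pts /= tnth_mktuple. Qed.

Definition mean_weight n (f : {ffun 'I_d -> 'I_n}) : \bar R :=
  (\int[Q n]_x (facet_weight (pts x) (pts x \o f))%:E)%E.

Let mW n (f : {ffun 'I_d -> 'I_n}) :
  measurable_fun [set: n.-tuple (d.-tuple R)]
    (fun x => (facet_weight (pts x) (pts x \o f))%:E).
Proof. by apply/measurable_EFinP; exact: measurable_facet_weight. Qed.

Lemma mean_weight_subsample m n (s : 'I_m -> 'I_n) (f : {ffun 'I_d -> 'I_m}) :
  injective s -> mean_weight f =
  (\int[Q n]_x (facet_weight (pts x \o s) (pts x \o s \o f))%:E)%E.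
Proof.
move=> s_inj.
pose G y : \bar R := (facet_weight (pts y) (pts y \o f))%:E.
have G0 y : (0 <= G y)%E by rewrite lee_fin facet_weight_ge0.
have E := integral_subsample (@hQ m) (@hQ n) s_inj (mW f) G0.
transitivity (\int[Q n]_x G (subsample s x))%E; first exact: esym E.
by apply: eq_integral => x _; rewrite /G pts_subsample.
Qed.

(** Exchangeability: a permutation of the sample carries [f] to [g] and changes neither the law nor
    the weight. *)
Lemma mean_weight_inj n (f g : {ffun 'I_d -> 'I_n}) :
  injective f -> injective g -> mean_weight f = mean_weight g.
Proof.
move=> f_inj g_inj; have [s sE] := perm_extension f_inj g_inj.
rewrite (mean_weight_subsample f (@perm_inj _ s)); apply: eq_integral => x _.
rewrite facet_weight_reindex; congr (facet_weight _ _)%:E.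
by apply/funext => i /=; rewrite sE.
Qed.

Let W0 n (f : {ffun 'I_d -> 'I_n}) : (0 <= mean_weight f)%E.
Proof. by apply: integral_ge0 => x _; rewrite lee_fin facet_weight_ge0. Qed.

Lemma mean_weight_fin n (f : {ffun 'I_d -> 'I_n}) : mean_weight f \is a fin_num.
Proof.
rewrite ge0_fin_numE //; apply: (@le_lt_trans _ _ (\int[Q n]_x (cst 2%:E x))%E).
  apply: ge0_le_integral => //; first by move=> x _; rewrite lee_fin facet_weight_ge0.
  - exact: mW.
  - by move=> x _; rewrite lee_fin facet_weight_le2.
rewrite integral_cst // [X in (_ * X)%E](_ : _ = 1%E) ?mule1 ?ltry //.
exact: probability_setT.
Qed.

(* Taking the last d indices makes [N.+1 + d] and [(N + d).+1] convertible. *)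
Definition tail_index N : {ffun 'I_d -> 'I_(N + d)} := [ffun i => rshift N i].

Lemma tail_index_inj N : injective (tail_index N).
Proof. by move=> i j; rewrite !ffunE => /rshift_inj. Qed.

(** The mean weight h_n for n = N + d; [fine] loses nothing, by [mean_weight_fin]. *)
Definition weight_seq N : R := fine (mean_weight (tail_index N)).

(** All the means are taken over one sample of N + 2 + d points, with two, one or no points left
    out, and the pointwise inequality [facet_weight_convex] is integrated. *)
Lemma weight_seq_convex N :
  2 * weight_seq N.+1 <= weight_seq N + weight_seq N.+2.
Proof.
rewrite /weight_seq; move: (tail_index N) (@tail_index_inj N) => f f_inj.
pose f1 : {ffun 'I_d -> 'I_(N.+1 + d)} := [ffun i => lift ord_max (f i)].
pose f2 : {ffun 'I_d -> 'I_(N.+2 + d)} := [ffun i => lift ord_max (f1 i)].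
have f1_inj : injective f1 by move=> i j; rewrite !ffunE => /lift_inj /f_inj.
have f2_inj : injective f2.
  by move=> i j; rewrite [LHS]ffunE [RHS]ffunE => /lift_inj /f1_inj.
(* [a] omits the last point, [b] the last but one; each gives one of the two copies of
   [weight_seq N.+1]. *)
pose a : 'I_(N.+1 + d) -> 'I_(N.+2 + d) := lift ord_max.
pose b : 'I_(N.+1 + d) -> 'I_(N.+2 + d) := lift (lift ord_max ord_max).
pose e : 'I_(N + d) -> 'I_(N.+1 + d) := lift ord_max.
have b_e i : b (e i) = a (e i).
  exact: lift_lift_max.
have a_inj : injective a by exact: lift_inj.
have b_inj : injective b by exact: lift_inj.
have e_inj : injective e by exact: lift_inj.
rewrite (mean_weight_inj (@tail_index_inj N.+1) f1_inj).
rewrite (mean_weight_inj (@tail_index_inj N.+2) f2_inj).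
rewrite -lee_fin mulr_natl mulr2n !EFinD !fineK ?mean_weight_fin //.
rewrite {1}(mean_weight_subsample f1 a_inj) (mean_weight_subsample f1 b_inj).
rewrite (mean_weight_subsample f (inj_comp a_inj e_inj)).
have mF m (s : 'I_m -> 'I_(N.+2 + d)) (k : {ffun 'I_d -> 'I_m}) :
    measurable_fun [set: (N.+2 + d).-tuple (d.-tuple R)]
      (fun x => (facet_weight (pts x \o s) (pts x \o s \o k))%:E).
  under eq_fun do rewrite -pts_subsample.
  exact: (measurableT_comp (mW k) (measurable_subsample s)).
have F0 m (p : 'I_m -> 'rV[R]_d) t : (0 <= (facet_weight p t)%:E)%E.
  by rewrite lee_fin facet_weight_ge0.
rewrite -!ge0_integralD //; try by [exact: mF|exact: mW|move=> x _; exact: F0].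
apply: ge0_le_integral => //.
- by move=> x _; rewrite adde_ge0.
- by apply: emeasurable_funD; exact: mF.
- by apply: emeasurable_funD; [exact: mF|exact: mW].
move=> x _; rewrite -!EFinD lee_fin.
have f1E : pts x \o a \o f1 = pts x \o a \o e \o f.
  by apply/funext => i; rewrite /= ffunE.
have f1E' : pts x \o b \o f1 = pts x \o a \o e \o f.
  by apply/funext => i; rewrite /= ffunE b_e.
have f2E : pts x \o f2 = pts x \o a \o e \o f.
  by apply/funext => i; rewrite /= ffunE ffunE.
rewrite f1E f1E' f2E; apply: facet_weight_convex.
rewrite -[X in (X <= _)%N]card_ord -(card_codom f_inj); apply: subset_leq_card.
by apply/fintype.subsetP => _ /codomP [i ->]; rewrite inE side_self.
Qed.

Hypothesis hgen : {ae Q d, forall x, affinely_independent (fun j => pt (tnth x j))}.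

(** Each injective tuple of the sample has the law of a sample of d points. The maps are enumerated
    through [unpickle], so that countably many almost sure events are intersected. *)
Lemma general_position n : {ae Q n, forall x, forall f : {ffun 'I_d -> 'I_n},
  injectiveb f -> affinely_independent (pts x \o f)}.
Proof.
pose ok (k : nat) (x : n.-tuple (d.-tuple R)) :=
  if unpickle k is Some f then
    injectiveb (f : {ffun 'I_d -> 'I_n}) -> affinely_independent (pts x \o f)
  else True.
suff : {ae Q n, forall x, forall k, ok k x}.
  apply: filterS => x okx f; have := okx (pickle f).
  by rewrite /ok pickleK.
apply: ae_foralln => k; rewrite /ok; case: (unpickle k) => [f|]; last exact: aeW.
case: (boolP (injectiveb f)) => [/injectiveP f_inj|_]; last by apply: aeW.
have [B [mB B0 Bsub]] := hgen.
exists (subsample f @^-1` B); split.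
- by rewrite -[X in measurable X]setTI; exact: measurable_subsample.
- exact: etrans (subsample_law (@hQ d) (@hQ n) f_inj mB) B0.
move=> x /= bad; apply: Bsub => /= good; apply: bad => _.
by move: good; rewrite -/(pts _) pts_subsample.
Qed.

(** The correction e_n for n = N + d. Under [hgen], a hyperplane containing the whole sample is
    almost surely the one spanned by the last d points. *)
Definition mean_degenerate N : \bar R := (\int[Q (N + d)]_x
  ((zeros (pts x) (pts x \o tail_index N) == [set: 'I_(N + d)]%SET)%:R)%:E)%E.

Let mean_degenerate_ge0 N : (0 <= mean_degenerate N)%E.
Proof. by apply: integral_ge0 => x _; rewrite lee_fin. Qed.

Lemma mean_degenerate_le1 N : (mean_degenerate N <= 1)%E.
Proof.
apply: (@le_trans _ _ (\int[Q (N + d)]_x (cst 1%:E x))%E).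
  apply: ge0_le_integral => //.
  - by apply/measurable_EFinP; exact: measurable_all_zeros.
  - by move=> x _; rewrite lee_fin; case: (_ == _).
rewrite integral_cst // mul1e; exact: probability_le1.
Qed.

Lemma mean_degenerate_decr N : (mean_degenerate N.+1 <= mean_degenerate N)%E.
Proof.
(* The first point is the one dropped, so that the last d points stay the same. *)
pose s : 'I_(N + d) -> 'I_(N.+1 + d) := lift ord0.
have s_inj : injective s by exact: lift_inj.
have sE i : s (tail_index N i) = tail_index N.+1 i.
  by apply: val_inj; rewrite !ffunE.
pose G (y : (N + d).-tuple (d.-tuple R)) : \bar R :=
  ((zeros (pts y) (pts y \o tail_index N) == [set: 'I_(N + d)]%SET)%:R)%:E.
have mG : measurable_fun [set: (N + d).-tuple (d.-tuple R)] G.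
  by apply/measurable_EFinP; exact: measurable_all_zeros.
have G0 y : (0 <= G y)%E by rewrite lee_fin.
have E := integral_subsample (@hQ (N + d)) (@hQ (N.+1 + d)) s_inj mG G0.
rewrite /mean_degenerate -/G -[X in (_ <= X)%E]E.
apply: ge0_le_integral => //.
- by apply/measurable_EFinP; exact: measurable_all_zeros.
- exact: (measurableT_comp mG (measurable_subsample s)).
move=> x _; rewrite /G lee_fin pts_subsample.
case: eqP => [zT|_]; last by case: (_ == _).
rewrite (_ : zeros _ _ = [set: 'I_(N + d)]%SET) ?eqxx //.
apply/setP => i; rewrite !inE; have : s i \in [set: 'I_(N.+1 + d)]%SET by rewrite inE.
rewrite -zT inE /= => /eqP <-; apply/eqP; congr (side _ _).
by apply/funext => j /=; rewrite sE.
Qed.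

(** [num_facets_sum] holds almost surely by general position; after integration every injective
    tuple contributes the same mean. *)
Lemma expected_facetsE N :
  (expected_facets (Q (N + d)) + mean_degenerate N =
   (((N + d) ^_ d)%N%:R * weight_seq N)%:E)%E.
Proof.
have mn := @measurable_num_facets R d (N + d) d_gt0.
transitivity (\sum_(f : {ffun 'I_d -> 'I_(N + d)} | injectiveb f) mean_weight f)%E.
  pose num x : \bar R := (num_facets (@pts R d (N + d) x))%:R%:E.
  pose deg x : \bar R :=
    (zeros (@pts R d (N + d) x) (pts x \o tail_index N) == [set: 'I_(N + d)]%SET)%:R%:E.
  have num0 x : (0 <= num x)%E by rewrite lee_fin.
  have deg0 x : (0 <= deg x)%E by rewrite lee_fin.
  have mnum : measurable_fun [set: (N + d).-tuple (d.-tuple R)] num.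
    exact/measurable_EFinP.
  have mdeg : measurable_fun [set: (N + d).-tuple (d.-tuple R)] deg.
    by apply/measurable_EFinP; exact: measurable_all_zeros.
  have weight0 (f : {ffun 'I_d -> 'I_(N + d)}) (x : (N + d).-tuple (d.-tuple R)) :
      (0 <= (facet_weight (pts x) (pts x \o f))%:E)%E.
    by rewrite lee_fin facet_weight_ge0.
  transitivity (\int[Q (N + d)]_x (num x + deg x))%E.
    by rewrite ge0_integralD //.
  rewrite -big_filter; set fs := [seq f <- _ | _].
  transitivity (\int[Q (N + d)]_x (\sum_(f <- fs)
      (facet_weight (pts x) (pts x \o f))%:E))%E; last first.
    rewrite ge0_integral_sum // => f; exact: mW.
  apply: ge0_ae_eq_integral => //.
  - exact: emeasurable_funD.
  - by apply: emeasurable_sum => f; exact: mW.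
  - by move=> x _; rewrite adde_ge0.
  - by move=> x _; exact: sume_ge0.
  move: (general_position (N + d)); apply: filterS => x gen _.
  rewrite -EFinD sumEFin big_filter; congr _%:E.
  apply: num_facets_sum => //; exact/injectiveP/tail_index_inj.
transitivity (\sum_(f in [set f : {ffun 'I_d -> 'I_(N + d)} | injectiveb f]%SET)
    (weight_seq N)%:E)%E.
  apply: eq_big => f; first by rewrite inE.
  move=> /injectiveP f_inj; rewrite /weight_seq fineK; last exact: mean_weight_fin.
  exact: mean_weight_inj f_inj (@tail_index_inj N).
by rewrite sumEFin sumr_const card_inj_ffuns !card_ord mulr_natl.
Qed.

End ExpectedFacets.

(** * Strict growth of the expected number of facets *)

Theorem theorem3 (R : realType) (d : nat) (hd : (0 < d)%N)
  (P : probability (d.-tuple R) R)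
  (Q : forall n : nat, probability (n.-tuple (d.-tuple R)) R)
  (hQ : forall n : nat, iid_law P (Q n))
  (hgen : {ae Q d, forall x, affinely_independent (fun j => pt (tnth x j))})
  (A c : R) (hA : 0 < A) (hc : 0 < c)
  (hasy : (fun n : nat => fine (expected_facets (Q n)) / (A * n%:R `^ c))
            @ \oo --> (1 : R)) :
  exists n0 : nat, forall n : nat, (n0 <= n)%N ->
    (expected_facets (Q n) < expected_facets (Q n.+1))%E.
Proof.
pose e N := fine (mean_degenerate Q N).
pose F N : R := ((N + d) ^_ d)%N%:R; pose h := weight_seq Q.
have e_fin N : mean_degenerate Q N \is a fin_num.
  rewrite ge0_fin_numE; first exact: le_lt_trans (mean_degenerate_le1 _ _) (ltry 1).
  by apply: integral_ge0 => x _; rewrite lee_fin.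
have e0 N : 0 <= e N.
  by rewrite fine_ge0 //; apply: integral_ge0 => x _; rewrite lee_fin.
have e1 N : e N <= 1 by rewrite -lee_fin fineK ?mean_degenerate_le1.
have EE N : expected_facets (Q (N + d)%N) = (F N * h N - e N)%:E.
  have := expected_facetsE hd hQ hgen N; rewrite -[mean_degenerate Q N]fineK //.
  (* The finite right-hand side rules out infinite values of the expectation. *)
  case: (expected_facets _) => [r| |] //; rewrite -EFinD => -[rE].
  by rewrite /F /h -rE addrK.
have h_convex N : 2 * h N.+1 <= h N + h N.+2 by exact: weight_seq_convex hQ N.
pose D N := A * (N + d)%N%:R `^ c.
have Dinv_cvg : (fun N => (D N)^-1) @ \oo --> (0 : R).
  rewrite (_ : (fun N => (D N)^-1) = (fun N => A^-1 * ((N + d)%N%:R `^ c)^-1)).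
    rewrite -[0 : R](mulr0 A^-1); apply: cvgM; first exact: cvg_cst.
    apply/gtr0_cvgV0; last exact: powR_cvgy.
    near=> N; apply: powR_gt0; rewrite ltr0n addn_gt0 hd orbT //.
  by apply/funext => N; rewrite invfM.
(* The correction [e N] lies in [0, 1] while [D N] tends to infinity, so the asymptotics pass to
   [F N * h N]. *)
have g_cvg : (fun N => F N * h N / D N) @ \oo --> (1 : R).
  rewrite (_ : (fun N => _) = (fun N =>
    fine (expected_facets (Q (N + d)%N)) / D N + e N / D N)); last first.
    by apply/funext => N; rewrite -mulrDl EE /= subrK.
  rewrite -[1 : R]addr0; apply: cvgD.
    by move: hasy; rewrite -(cvg_shiftn d).
  apply: (@squeeze_cvgr _ _ _ _ (fun=> 0) (fun N => (D N)^-1)) => //; last exact: cvg_cst.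
  apply: nearW => N; have D0 : 0 <= (D N)^-1.
    by rewrite invr_ge0 mulr_ge0 ?powR_ge0 // ltW.
  by rewrite mulr_ge0 //= ler_piMl.
have [N0 HN0] := eventually_increasing hA hc h_convex g_cvg.
exists (N0 + d)%N => n nN0; have dn : (d <= n)%N by apply: leq_trans nN0; rewrite leq_addl.
rewrite -(subnK dn) -addSn !EE lte_fin; set N := (n - d)%N.
have N0N : (N0 <= N)%N by rewrite leq_subRL // addnC.
(* Since [e] is nonincreasing, replacing [e N.+1] by [e N] only lowers the larger side. *)
apply: (lt_le_trans (y := F N.+1 * h N.+1 - e N)); first by rewrite ltrD2r HN0.
rewrite lerD2l lerN2 fine_le //.
exact: mean_degenerate_decr hQ N.
Unshelve. all: by end_near.
Qed.
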